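(* For every integer $k$, there are infinitely many primes (arith $k$).
   Context: For $m,n,k\in\mathbb{Z}$ the $k$-arithmetic product is $m\odot_k n=(m-n+1)\cdot n+\frac{n(n-1)k}{2}\in\mathbb{Z}$, where the operations on the right are the usual ones. (For $n>0$ this is the sum of the $n$ terms of the arithmetic progression with first term $m-n+1$ and difference $k$.) An integer $d>0$ is called a divisor of $a\in\mathbb{Z}$ (arith $k$) if there exists $b\in\mathbb{Z}$ such that $b\odot_k d=a$; divisors are always positive. An integer $p>1$ is called a prime (arith $k$), or $k$-prime, if it has exactly two divisors (arith $k$). The paper writes $\mathcal{Z}_k=\{\mathbb{Z},+,\odot_k,<\}$ and calls the primes (arith $k$) the primes on $\mathcal{Z}_k$. *)

(* Defs.v *)
From mathcomp Require Import all_boot all_order all_algebra.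
From mathcomp Require Import classical_sets cardinality.

Set Implicit Arguments.
Unset Strict Implicit.
Unset Printing Implicit Defensive.

Import Order.TTheory GRing.Theory Num.Theory.
Local Open Scope classical_set_scope.
Local Open Scope card_scope.
Local Open Scope ring_scope.

(* The division by 2 is exact since n * (n - 1) is even. *)
Definition arith_mul (k m n : int) : int :=
  (m - n + 1) * n + (n * (n - 1) * k %/ 2)%Z.

Definition arith_divisors (k a : int) : set int :=
  [set d | 0 < d /\ exists b : int, arith_mul k b d = a].

Definition arith_prime (k p : int) : Prop :=
  1 < p /\ arith_divisors k p #= `I_2.

(* Main.v *)
Require Import Defs.
From mathcomp Require Import all_boot all_order all_algebra.
From mathcomp Require Import classical_sets cardinality.
From mathcomp Require Import ring zify.

Set Implicit Arguments.
Unset Strict Implicit.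
Unset Printing Implicit Defensive.

Import Order.TTheory GRing.Theory Num.Theory.
Local Open Scope classical_set_scope.
Local Open Scope ring_scope.

(** For even [k] the divisors (arith [k]) are the usual ones, so the usual
    primes are [k]-prime. For odd [k], [d] divides [a] iff [2 * a / d] is an
    integer of parity opposite to that of [d]; for [a = 2 ^ n] this leaves only
    [d = 1] and [d = 2 ^ n.+1], so every [2 ^ n] with [n > 0] is [k]-prime. *)

(** If a list [s] enumerated [A], the sum of the absolute values over [s] would bound every element
    of [A]. *)
Lemma infinite_set_int_unbounded (A : set int) :
  (forall n : nat, exists2 m : nat, (n < m)%N & A m%:Z) -> infinite_set A.
Proof.
move=> unbA /finite_seqP[s As].
have [m + /[!As] /= ms] := unbA (\sum_(x <- s) `|x|)%N.
by rewrite (big_rem _ ms) /= ltnNge leq_addr.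
Qed.

Lemma card_set2 (T : Type) (x y : T) : x <> y -> ([set x; y] #= `I_2)%card.
Proof.
move=> neq_xy; apply/eq_cardSP; exists x; first by left.
suff -> : [set x; y] `\ x = [set y] by exact: card_set1.
apply/seteqP; split=> z /=; first by case=> -[].
by move=> ->; split; [right | exact: nesym].
Qed.

(** Doubling turns the later arguments into polynomial identities, free of integer division. *)
Lemma arith_mul2 (k m n : int) :
  2 * arith_mul k m n = 2 * (m - n + 1) * n + n * (n - 1) * k.
Proof.
have dv2 : (2 %| n * (n - 1) * k)%Z.
  apply: dvdz_mulr; have [q [->|->]] : exists q, n = q * 2 \/ n = q * 2 + 1.
  - by exists (n %/ 2)%Z; lia.
  - by rewrite -mulrA mulrCA dvdz_mulr // mulrC dvdz_mulr.
  - by rewrite addrK mulrA dvdz_mull.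
by rewrite /arith_mul mulrDr mulrA [2 * (_ %/ _)%Z]mulrC divzK.
Qed.

(** The substitution [c = b - d + 1] is a bijection of the integers, and [d] factors out of the
    doubled product. *)
Lemma arith_divisorsE (k a d : int) : arith_divisors k a d <->
  0 < d /\ exists c : int, 2 * a = d * (2 * c + (d - 1) * k).
Proof.
split=> -[d_gt0 [b Db]]; split=> //.
  by exists (b - d + 1); rewrite -Db arith_mul2; ring.
exists (b + d - 1); apply: (@mulfI _ 2) => //.
by rewrite arith_mul2 Db; ring.
Qed.

(** Here the progression term only shifts the cofactor: [c + (d - 1) * j] takes every integer value
    as [c] varies. *)
Lemma arith_divisors_even (j : int) (a : nat) (d : int) :
  arith_divisors (2 * j) a%:Z d <-> 0 < d /\ (`|d| %| a)%N.
Proof.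
rewrite arith_divisorsE; split=> -[d_gt0 dv]; split=> //.
  have [c Dc] := dv.
  suff Da : a%:Z = (c + (d - 1) * j) * d.
    by rewrite -[a]absz_nat -dvdzE; apply/dvdzP; exists (c + (d - 1) * j).
  by apply: (@mulfI _ 2) => //; rewrite Dc; ring.
have /dvdzP[c Dc] : (d %| a%:Z)%Z by rewrite dvdzE.
by exists (c - (d - 1) * j); rewrite Dc; ring.
Qed.

(** With [k = 2 * j + 1] the cofactor of [d] is [2 * (c + (d - 1) * j) + (d - 1)], which as [c]
    varies takes exactly the values congruent to [d - 1] modulo 2. It is nonnegative because [d > 0]
    and [a >= 0]. *)
Lemma arith_divisors_odd (j : int) (a : nat) (d : int) :
  arith_divisors (2 * j + 1) a%:Z d <->
  0 < d /\ exists2 e : nat, (2 * a = `|d| * e)%N & odd e != odd `|d|.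
Proof.
rewrite arith_divisorsE; split=> -[d_gt0]; last first.
  case=> e Da par; split=> //.
  have [c Dc] : exists c : int, e%:Z = d - 1 + 2 * c.
    by exists ((e%:Z - d + 1) %/ 2)%Z; lia.
  exists (c - (d - 1) * j).
  have -> : 2 * a%:Z = d * e%:Z by rewrite -{1}(gtz0_abs d_gt0); lia.
  by rewrite Dc; ring.
case=> c Dc; split=> //.
set e : int := 2 * (c + (d - 1) * j) + (d - 1).
have De : 2 * a%:Z = d * e by rewrite Dc /e; ring.
have e_ge0 : 0 <= e by rewrite -(pmulr_rge0 _ d_gt0) -De.
exists `|e|%N; first by rewrite -abszM -De; lia.
by move: e_ge0; rewrite /e; set t := c + _ => e_ge0; lia.
Qed.

Lemma arith_prime_even (j : int) (p : nat) :
  prime p -> arith_prime (2 * j) p%:Z.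
Proof.
move=> pr_p; have p_gt1 := prime_gt1 pr_p; split; first by [].
suff -> : arith_divisors (2 * j) p%:Z = [set 1; p%:Z].
  by apply: card_set2; lia.
apply/seteqP; split=> d /=; rewrite arith_divisors_even.
  case=> d_gt0; have /primeP[_ dv_p] := pr_p.
  by move=> /dv_p/orP[]/eqP; [left | right]; lia.
by case=> ->; split=> //; rewrite ltz_nat prime_gt0.
Qed.

Lemma arith_prime_odd (j : int) (n : nat) :
  (0 < n)%N -> arith_prime (2 * j + 1) (2 ^ n)%N%:Z.
Proof.
move=> n_gt0; have n_lt := ltn_expl n (isT : 1 < 2)%N; split; first by lia.
suff -> : arith_divisors (2 * j + 1) (2 ^ n)%N%:Z = [set 1; (2 ^ n.+1)%N%:Z].
  by apply: card_set2; rewrite expnS; lia.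
apply/seteqP; split=> d /=; rewrite arith_divisors_odd -expnS.
  case=> d_gt0 [e Dn].
  have /dvdn_pfactor[//|i i_le Dd] : (`|d| %| 2 ^ n.+1)%N.
    by rewrite Dn dvdn_mulr.
  have -> : e = (2 ^ (n.+1 - i))%N.
    apply/eqP; rewrite -(eqn_pmul2l (_ : 0 < 2 ^ i)%N) ?expn_gt0 //.
    by rewrite -Dd -Dn Dd -expnD subnKC.
  (* A power of 2 is odd only for exponent 0, so opposite parities mean that exactly one of [i] and
     [n.+1 - i] vanishes. *)
  rewrite Dd !oddX !orbF subn_eq0 => par.
  have [i0|i0] : i = 0%N \/ i = n.+1 by lia.
    by left; move: Dd; rewrite i0; lia.
  by right; move: Dd; rewrite i0; lia.
case=> ->; split=> //=.
- by exists (2 ^ n.+1)%N; rewrite ?mul1n ?oddX.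
- by rewrite ltz_nat expn_gt0.
- by exists 1%N; rewrite ?muln1 ?oddX.
Qed.

Theorem theorem3 (k : int) : infinite_set [set p : int | arith_prime k p].
Proof.
apply: infinite_set_int_unbounded => n.
have [j [->|->]] : exists j, k = 2 * j \/ k = 2 * j + 1.
- by exists (k %/ 2)%Z; lia.
- have [p p_gt pr_p] := prime_above n.
  by exists p => //; apply: arith_prime_even.
(* The exponent [n.+1] is positive even for [n = 0], as [arith_prime_odd] requires. *)
- exists (2 ^ n.+1)%N; first by rewrite ltnW // ltn_expl.
  exact: arith_prime_odd.
Qed.
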